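(* There exists an uncountable subset $G^{*}\subset Y_S$ such that if $y\in G^{*}$, then there exist ten sequences of positive integers $\{n_{i,j}\}_{i=1}^{\infty}$, $1\le j\le 10$, such that $$\lim_{i\to\infty}R_{n_{i,j}}(y)=R_j\qquad\text{for each } 1\le j\le 10.$$
   Context: $\phi=(\sqrt5+1)/2$. For irrational $t\in(0,1)$, $[0,a_1(t),a_2(t),\dots]$ is its regular continued fraction expansion and $c_i(t)/d_i(t)$ is its $i$-th convergent in lowest terms. Let $$S=\{t\in(0,1)\setminus\mathbb{Q}:\ a_{i+1}(t)\ge\phi^{d_i(t)}\text{ for infinitely many } i\},\qquad Y_S=\{\exp(2\pi i t):t\in S\}.$$ For $x$ on the unit circle let $K_n(x)=P_n(x)/Q_n(x)$ be the $n$-th convergent of $K(x)=1+\cfrac{x}{1+\cfrac{x^2}{1+\cfrac{x^3}{1+\ddots}}}$, where $P_0=1$, $P_1=1+x$, $Q_0=Q_1=1$, $P_{n+1}=P_n+x^{n+1}P_{n-1}$, $Q_{n+1}=Q_n+x^{n+1}Q_{n-1}$ for $n\ge 1$. Let $R_n(x)=x^{1/5}/K_n(x)$ (the $n$-th convergent of the Rogers-Ramanujan continued fraction $R(x)$), where for $x=\exp(2\pi i t)$, $t\in[0,1)$, one takes $x^{1/5}=\exp(2\pi i t/5)$. The ten numbers $R_j$ (the values taken by $R(x)$ at roots of unity) are $$R_j=-\phi\exp(2\pi i j/5)\ \ (1\le j\le5),\qquad R_j=\frac{\exp(2\pi i j/5)}{\phi}\ \ (6\le j\le10).$$ *)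

(* Defs.v *)
From HB Require Import structures.
From mathcomp Require Import all_boot all_order all_algebra.
From mathcomp Require Import all_classical all_reals all_analysis.
From mathcomp Require Export complex.

Set Implicit Arguments.
Unset Strict Implicit.
Unset Printing Implicit Defensive.

Import Order.TTheory GRing.Theory Num.Theory numFieldNormedType.Exports.

Local Open Scope classical_set_scope.
Local Open Scope ring_scope.
Local Open Scope complex_scope.

Section RegularContinuedFraction.
Variable R : realType.
Implicit Types t : R.

Definition gauss_map t : R := t^-1 - (Num.truncn t^-1)%:R.

(* t = [a_0; a_1, a_2, ...] for t in (0,1), so that a_0 = 0. *)
Definition partial_quotient t (i : nat) : nat :=
  if i is k.+1 then Num.truncn (iter k gauss_map t)^-1 else 0%N.

(* [a_0; a_1, ..., a_i]; the base value 0 is harmless since 0^-1 = 0. *)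
Definition cf_convergent t (i : nat) : rat :=
  foldr (fun a q => a%:R + q^-1) 0
    [seq partial_quotient t k | k <- iota 0 i.+1].

(* A rat is stored in lowest terms with positive denominator. *)
Definition cf_denominator t (i : nat) : nat := `|denq (cf_convergent t i)|%N.

Definition phi : R := (Num.sqrt 5 + 1) / 2.

Definition set_S : set R :=
  [set t | 0 < t < 1 /\ irrational t /\
    infinite_set [set i : nat |
      phi ^+ cf_denominator t i <= (partial_quotient t i.+1)%:R]].

End RegularContinuedFraction.

Section RogersRamanujan.
Variable R : realType.
Implicit Types (t : R) (x : R[i]).

(* exp (2 pi i t) *)
Definition exp2pii t : R[i] := cos (2 * pi * t) +i* sin (2 * pi * t).

Definition Y_S : set R[i] := exp2pii @` set_S (R := R).

(* The pair (P_n.+1 x, P_n x). *)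
Fixpoint num_pair (n : nat) x : R[i] * R[i] :=
  if n is k.+1 then
    let: (p1, p0) := num_pair k x in (p1 + x ^+ k.+2 * p0, p1)
  else (1 + x, 1).

Definition P_num (n : nat) x : R[i] := (num_pair n x).2.

(* The pair (Q_n.+1 x, Q_n x). *)
Fixpoint den_pair (n : nat) x : R[i] * R[i] :=
  if n is k.+1 then
    let: (q1, q0) := den_pair k x in (q1 + x ^+ k.+2 * q0, q1)
  else (1, 1).

Definition Q_den (n : nat) x : R[i] := (den_pair n x).2.

Definition K_conv (n : nat) x : R[i] := P_num n x / Q_den n x.

(* The unique t in [0, 1) with x = exp (2 pi i t), for x on the unit circle. *)
Definition turn x : R := xget 0 [set t | 0 <= t < 1 /\ exp2pii t = x].

Definition fifth_root x : R[i] := exp2pii (turn x / 5).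

(* As z / 0 = 0, this has the right value 0 when K_conv n x is infinite
   (Q_den n x = 0), and 0 instead of infinity when P_num n x = 0. Since the limits
   considered are nonzero, neither can occur along a tail of a convergent
   sequence. *)
Definition RR (n : nat) x : R[i] := fifth_root x / K_conv n x.

(* Meaningful for 1 <= j <= 10. *)
Definition RR_limit (j : nat) : R[i] :=
  if (j <= 5)%N then - (phi R)%:C * exp2pii (j%:R / 5)
  else exp2pii (j%:R / 5) / (phi R)%:C.

End RogersRamanujan.

(* Main.v *)
Require Import Defs.
From mathcomp Require Import all_boot all_order all_algebra.
From mathcomp Require Import all_classical all_reals all_analysis.
From mathcomp Require Import ring lra zify.
Import Order.TTheory GRing.Theory Num.Theory numFieldNormedType.Exports.
Local Open Scope classical_set_scope.
Local Open Scope ring_scope.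

Set Implicit Arguments.
Unset Strict Implicit.
Unset Printing Implicit Defensive.

(** The set [G] consists of the points exp(2 pi i t) for [t] generic in the
    sense of Baire category: both requirements on [t] are countable families of
    conditions, each of which holds on a dense open subset of (0,1).

    Membership in S.  A number [t] whose expansion starts with a word [w] and
    continues with a remainder [y] in (0,1) has [w] as its first partial
    quotients, and the next one is the integer part of 1/y, while the
    denominator that it is compared with depends on [w] alone.  So the
    inequality defining S at rank [size w] holds on a whole one-sided
    neighbourhood of the rational number with expansion [w], and such rational
    numbers, of arbitrarily large rank, are dense ([large_quotient_dense]).

    Approximation of R_j.  For a fixed [n] the map sending [t] to
    R_n(exp(2 pi i t)) is continuous wherever P_n does not vanish ([RR_near]).
    It is therefore enough to find, near any given turn, a root of unity at
    which some convergent is close to R_j ([RR_dense]).  Let x be a primitive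
    m-th root of unity.  Shifting the index of P and Q by m is a linear map
    given by P_(m-1), P_m, Q_(m-1), Q_m.  Schur's finite form of the
    Rogers-Ramanujan identities ([schur_identity]) writes these numbers as
    alternating sums of Gaussian binomials of top index m and m + 1, nearly
    all of which vanish at x.  For even m what survives gives, with a suitable
    power g of x,

      m = 1 mod 5:  P_(km-1) = F_(k+1) and Q_(km-1) = g F_k,
      m = 2 mod 5:  P_(km-1) = F_(k-1) and Q_(km-1) = g F_k,

    where F denotes the Fibonacci numbers.  For x = exp(2 pi i c/m) the factor g and the
    fifth root of x combine to exp(2 pi i c/5), respectively
    exp(2 pi i c/10) ([RR_root_5r3], [RR_root_5r1]), and letting k grow gives
    exp(2 pi i c/5) / phi, respectively phi exp(2 pi i c/10).  The orders
    m = 16^k and m = 2 * 16^k realise the two classes, and prescribing the odd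
    number c modulo 10 leaves the fractions c/m dense.

    By Baire's theorem the generic [t] are uncountably many: otherwise the
    complements of these points could be added to the family of dense open
    sets ([uncountable_generic_turns]). *)

(** * Gaussian binomials and Schur's identity *)

Section GaussianBinomial.
Variables (K : fieldType) (q : K).
Hypothesis q0 : q != 0.

(** The lower index is an integer so that Schur's sums can run over all
    integers, with no side conditions on the indices. *)
Fixpoint qbin (n : nat) (l : int) : K :=
  if n is p.+1 then qbin p (l - 1) + q ^ l * qbin p l else (l == 0)%:R.

Lemma qbinS n l : qbin n.+1 l = qbin n (l - 1) + q ^ l * qbin n l.
Proof. by []. Qed.

(** The mirror image of the defining recursion; Schur's recurrence comes from
    playing the two recursions against each other. *)
Lemma qbinS' n l : qbin n.+1 l = qbin n l + q ^ (n.+1%:Z - l) * qbin n (l - 1).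
Proof.
elim: n l => [|n IH] l.
  rewrite qbinS /= subr_eq0.
  have [->|_] := eqVneq l 1.
    by rewrite oner_eq0 subrr expr0z mulr0 addrC mul1r.
  by have [->|_] := eqVneq l 0; rewrite ?expr0z !mulr0 addrC ?mul1r.
rewrite qbinS {1}IH {1}(IH l) [qbin n.+1 l]qbinS [qbin n.+1 (l - 1)]qbinS.
have e1 : q ^ (n.+1%:Z - (l - 1)) = q ^ (n.+2%:Z - l).
  by congr (_ ^ _); lia.
have e2 : q ^ l * q ^ (n.+1%:Z - l) = q ^ (n.+2%:Z - l) * q ^ (l - 1).
  by rewrite -!expfzDr //; congr (_ ^ _); lia.
rewrite e1.
set a := qbin n (l - 1 - 1); set b := qbin n (l - 1); set c := qbin n l.
rewrite [q ^ l * (c + _)]mulrDr mulrA e2; ring.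
Qed.

Lemma qbin_lt0 n l : l < 0 -> qbin n l = 0.
Proof.
elim: n l => [|n IH] l l0; first by rewrite /= (lt_eqF l0).
by rewrite qbinS !IH ?mulr0 ?addr0 //; lia.
Qed.

Lemma qbin_gt n l : n%:Z < l -> qbin n l = 0.
Proof.
elim: n l => [|n IH] l l0; first by rewrite /= (gt_eqF l0).
by rewrite qbinS !IH ?mulr0 ?addr0 //; lia.
Qed.

Lemma qbin0 n : qbin n 0 = 1.
Proof.
elim: n => [|n IH]; first by [].
by rewrite qbinS IH qbin_lt0 // expr0z mul1r add0r.
Qed.

Lemma qbinnn n l : l = n%:Z -> qbin n l = 1.
Proof.
move=> ->; elim: n => [|n IH]; first by [].
rewrite qbinS (@qbin_gt n n.+1%:Z) ?mulr0 ?addr0; last by lia.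
by rewrite -IH; congr qbin; lia.
Qed.

(** The difference of the two Pascal rules. *)
Lemma qbin_absorb n l :
  (1 - q ^ l) * qbin n.+1 l = (1 - q ^ n.+1%:Z) * qbin n (l - 1).
Proof.
have e : q ^ l * q ^ (n.+1%:Z - l) = q ^ n.+1%:Z.
  by rewrite -expfzDr //; congr (_ ^ _); lia.
rewrite mulrBl mul1r {1}qbinS qbinS' mulrDr mulrA e; ring.
Qed.

(** The absorption identity loses its right-hand side when [q ^+ n = 1]. *)
Lemma qbin_root n l : q ^+ n = 1 -> 0 < l < n%:Z -> q ^ l != 1 -> qbin n l = 0.
Proof.
case: n => [|n] qn ln ql; first by lia.
have /eqP := qbin_absorb n l; rewrite -exprnP qn subrr mul0r mulf_eq0 subr_eq0.
by rewrite eq_sym (negbTE ql) /= => /eqP.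
Qed.

(** In Schur's sum over k of (-1)^k q^(k(5k+1)/2) times a Gaussian binomial of
    lower index floor((n-5k)/2), the summands k = 2i and k = 2i + 1 are paired,
    which removes the halves and the signs.  That sum gives the numerators and
    is the case [s = 0].  For the denominators, [s = 1], the exponent is
    k(5k-3)/2 and the lower index is raised by 1. *)
Definition schur_even_exp (s i : int) : int := 10 * i * i + i - 4 * i * s.
Definition schur_odd_exp (s i : int) : int :=
  10 * i * i + 11 * i + 3 - 4 * i * s - 2 * s.

(** The summand of index [i] for an even, respectively odd, top index. *)
Definition schur_even_term (s : int) (h : nat) (i : int) : K :=
  q ^ schur_even_exp s i * qbin h.*2 (h%:Z - 5 * i + s)
  - q ^ schur_odd_exp s i * qbin h.*2 (h%:Z - 3 - 5 * i + s).
Definition schur_odd_term (s : int) (h : nat) (i : int) : K :=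
  q ^ schur_even_exp s i * qbin h.*2.+1 (h%:Z - 5 * i + s)
  - q ^ schur_odd_exp s i * qbin h.*2.+1 (h%:Z - 2 - 5 * i + s).

(** What remains of [schur_odd_termS] once the powers of [q] and the Gaussian
    binomials are treated as unknowns. *)
Lemma schur_step_ring (ce co a b c d w A B C D E : K) :
  a * b = w -> c * d = w -> ce * a = co * c ->
  ce * (A + a * (C + b * D)) - co * (B + c * (C + d * E)) =
  ce * A - co * B + w * (ce * D - co * E).
Proof.
move=> abw cdw ac.
rewrite !(mulrDr a) !(mulrDr c) !(mulrA _ b) !(mulrA _ d) abw cdw.
by rewrite !(mulrDr ce) !(mulrDr co) !(mulrA ce a) !(mulrA co c) ac; ring.
Qed.

(** From an even to an odd top index the recurrence holds summand by summand:
    after applying both Pascal rules the two leftover terms coincide. *)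
Lemma schur_odd_termS s h i : schur_odd_term s h.+1 i =
  schur_even_term s h.+1 i + q ^+ h.+1.*2 * schur_odd_term s h i.
Proof.
rewrite /schur_odd_term /schur_even_term doubleS.
set ce := q ^ schur_even_exp s i; set co := q ^ schur_odd_exp s i.
set l1 := h.+1%:Z - 5 * i + s; set l2 := h.+1%:Z - 2 - 5 * i + s.
rewrite [qbin h.*2.+3 l1]qbinS' [qbin h.*2.+3 l2]qbinS.
rewrite [qbin _ (l1 - 1)]qbinS [qbin _.+2 l2]qbinS'.
have -> : h.+1%:Z - 3 - 5 * i + s = l2 - 1 by rewrite /l2; ring.
have -> : h%:Z - 5 * i + s = l1 - 1 by rewrite /l1; lia.
have -> : l1 - 1 - 1 = l2 by rewrite /l1 /l2; ring.
apply: schur_step_ring.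
- by rewrite exprnP -!expfzDr //; congr (_ ^ _); lia.
- by rewrite exprnP -!expfzDr //; congr (_ ^ _); lia.
rewrite -!expfzDr //; congr (_ ^ _).
rewrite /schur_even_exp /schur_odd_exp /l1 /l2.
have -> : h.*2.+3%:Z = 2 * h%:Z + 3 by lia.
by rewrite intS; ring.
Qed.

(** From an odd to an even top index the two leftover terms no longer cancel
    within one summand; they are consecutive values of this function, so that
    they telescope in the sum. *)
Definition schur_boundary (s : int) (h : nat) (i : int) : K :=
  q ^ (schur_even_exp s i + (h.+1%:Z - 5 * i + s))
  * qbin h.*2 (h.+1%:Z - 5 * i + s).

Lemma schur_even_termS s h i : schur_even_term s h.+1 i =
  schur_odd_term s h i + q ^+ h.*2.+1 * schur_even_term s h i
  + (schur_boundary s h i - schur_boundary s h (i + 1)).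
Proof.
rewrite /schur_odd_term /schur_even_term /schur_boundary doubleS.
set l1 := h.+1%:Z - 5 * i + s; set l2 := h%:Z - 2 - 5 * i + s.
rewrite [qbin h.*2.+2 l1]qbinS [qbin h.*2.+2 l2]qbinS'.
rewrite [qbin _ l1]qbinS' [qbin _.+1 (l2 - 1)]qbinS.
have -> : h%:Z - 5 * i + s = l1 - 1 by rewrite /l1; lia.
have -> : h%:Z - 3 - 5 * i + s = l2 - 1 by rewrite /l2; ring.
have -> : h.+1%:Z - 5 * (i + 1) + s = l2 - 1 - 1 by rewrite /l2; lia.
have -> : schur_even_exp s (i + 1) + (l2 - 1 - 1) =
          schur_odd_exp s i + (h.*2.+2%:Z - l2).
  rewrite /schur_even_exp /schur_odd_exp /l2.
  have -> : h.*2.+2%:Z = 2 * h%:Z + 2 by lia.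
  by ring.
rewrite !(expfzDr (schur_even_exp _ _)) // !(expfzDr (schur_odd_exp _ _)) //.
have e1 : q ^ l1 * q ^ (h.*2.+1%:Z - l1) = q ^+ h.*2.+1.
  by rewrite exprnP -!expfzDr //; congr (_ ^ _); lia.
have e2 : q ^ (h.*2.+2%:Z - l2) * q ^ (l2 - 1) = q ^+ h.*2.+1.
  by rewrite exprnP -!expfzDr //; congr (_ ^ _); lia.
rewrite (mulrDr (q ^ l1)) (mulrDr (q ^ (_ - l2))) (mulrA (q ^ l1)).
rewrite (mulrA (q ^ (_ - l2))) e1 e2; ring.
Qed.

(** Any [N] beyond the range of the nonzero summands gives the sum over all
    integers. *)
Definition schur_even_sum (s : int) (h N : nat) : K :=
  \sum_(0 <= k < N.*2) schur_even_term s h (k%:Z - N%:Z).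
Definition schur_odd_sum (s : int) (h N : nat) : K :=
  \sum_(0 <= k < N.*2) schur_odd_term s h (k%:Z - N%:Z).

Lemma schur_odd_sumS s h N : schur_odd_sum s h.+1 N =
  schur_even_sum s h.+1 N + q ^+ h.+1.*2 * schur_odd_sum s h N.
Proof.
rewrite /schur_odd_sum /schur_even_sum mulr_sumr -big_split /=.
by apply: eq_bigr => k _; rewrite schur_odd_termS.
Qed.

Lemma schur_even_sumS s h N : 0 <= s <= 1 -> (h < N)%N ->
  schur_even_sum s h.+1 N =
  schur_odd_sum s h N + q ^+ h.*2.+1 * schur_even_sum s h N.
Proof.
move=> s01 hN.
pose G k := - schur_boundary s h (k%:Z - N%:Z).
have G0 : \sum_(0 <= k < N.*2) (G k.+1 - G k) = 0.
  rewrite telescope_sumr // /G /schur_boundary.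
  by rewrite qbin_lt0 ?qbin_gt ?mulr0 ?subrr //; lia.
rewrite -[RHS]addr0 -G0 /schur_odd_sum /schur_even_sum mulr_sumr -!big_split /=.
apply: eq_bigr => k _; rewrite schur_even_termS /G opprK [- _ + _]addrC.
by congr (_ + (_ - schur_boundary s h _)); lia.
Qed.

Lemma sum_pick N (i0 : int) (v : K) : - N%:Z <= i0 < N%:Z ->
  \sum_(0 <= k < N.*2) (k%:Z - N%:Z == i0)%:R * v = v.
Proof.
move=> iN; have [k0 k0N ki] : exists2 k0, (k0 < N.*2)%N & k0%:Z - N%:Z = i0.
  by exists `|(i0 + N%:Z)%R|%N; lia.
rewrite (bigD1_seq k0) ?iota_uniq ?mem_index_iota ?big1_seq //=.
  by rewrite ki eqxx mul1r addr0.
move=> k /andP[kk0 _]; rewrite (_ : (_ == _) = false) ?mul0r //.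
by apply/negbTE; apply: contraNneq kk0 => kN; apply/eqP; lia.
Qed.

Lemma qbin1 l : qbin 1 l = (l == 0)%:R + (l == 1)%:R.
Proof.
rewrite qbinS /= subr_eq0 addrC.
by have [->|_] := eqVneq l 0; rewrite ?expr0z ?mul1r ?mulr0.
Qed.

Lemma schur_sum0 (s : int) N : 0 <= s <= 1 ->
  schur_even_sum s 0 N.+1 = (s == 0)%:R /\ schur_odd_sum s 0 N.+1 = 1.
Proof.
move=> s01; split.
  rewrite -[RHS](@sum_pick N.+1 0); last by lia.
  apply: eq_bigr => k _; move: (_ - _) => i; rewrite /schur_even_term.
  rewrite /= (_ : (0 - 5 * i + s == 0) = (i == 0) && (s == 0)); last by lia.
  rewrite (_ : (0 - 3 - 5 * i + s == 0) = false); last by lia.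
  rewrite mulr0 subr0; have [->|_] := eqVneq i 0; last by rewrite mulr0 mul0r.
  by have [->|_] := eqVneq s 0; rewrite /= ?mulr0 // expr0z mulr1.
rewrite -[RHS](@sum_pick N.+1 0); last by lia.
apply: eq_bigr => k _; move: (_ - _) => i; rewrite /schur_odd_term !qbin1.
rewrite (_ : (0 - 5 * i + s == 0) = (i == 0) && (s == 0)); last by lia.
rewrite (_ : (0 - 5 * i + s == 1) = (i == 0) && (s == 1)); last by lia.
rewrite (_ : (0 - 2 - 5 * i + s == 0) = false); last by lia.
rewrite (_ : (0 - 2 - 5 * i + s == 1) = false); last by lia.
have [->|_] := eqVneq i 0; last by rewrite /= addr0 !mulr0 subr0 mul0r.
have [->|->] : s = 0 \/ s = 1 by lia.
all: by rewrite /schur_even_exp /= expr0z ?addr0 ?add0r !mulr0 subr0.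
Qed.

(** A sequence satisfying the recurrence of the Rogers-Ramanujan convergents is
    determined by its first two terms, so it is enough that Schur's sums satisfy
    the same recurrence. *)
Lemma schur_identity (s : int) (u : nat -> K) (N h : nat) : 0 <= s <= 1 ->
    u 0%N = (s == 0)%:R -> u 1%N = 1 ->
    (forall n, u n.+2 = u n.+1 + q ^+ n.+1 * u n) -> (h < N)%N ->
  u h.*2 = schur_even_sum s h N /\ u h.*2.+1 = schur_odd_sum s h N.
Proof.
move=> s01 u0 u1 uS; elim: h => [|h IH] hN.
  by case: N hN => // N _; have [-> ->] := schur_sum0 N s01.
have [//|e o] := IH _; first by lia.
have eS : u h.+1.*2 = schur_even_sum s h.+1 N.
  by rewrite doubleS uS schur_even_sumS // ?e ?o //; lia.
by split=> //; rewrite schur_odd_sumS -eS -o doubleS uS.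
Qed.

(** * Schur's sums at a root of unity of even order *)

Section RootOfUnity.
Variable h : nat.
Hypothesis h0 : (0 < h)%N.
Hypothesis qh : q ^+ h = -1.
Hypothesis q_prim : forall l : nat, (0 < l < h.*2)%N -> q ^+ l != 1.

Lemma q_order : q ^+ h.*2 = 1.
Proof. by rewrite -addnn exprD qh mulrNN mulr1. Qed.

Lemma qbin_order l : qbin h.*2 l = (l == 0)%:R + (l == h.*2%:Z)%:R.
Proof.
have [->|l0] := eqVneq l 0.
  by rewrite qbin0 (_ : _ == _ = false) ?addr0 //; lia.
have [->|lm] := eqVneq l h.*2%:Z; first by rewrite qbinnn ?add0r.
rewrite addr0; have [lt0|le0] := ltrP l 0; first by rewrite qbin_lt0.
have [gtm|lem] := ltrP h.*2%:Z l; first by rewrite qbin_gt.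
apply: qbin_root; rewrite ?q_order //; first by lia.
by case: l l0 lm le0 lem => // l *; apply: q_prim; lia.
Qed.

Lemma qbin_orderS l : qbin h.*2.+1 l =
  (l == 0)%:R + (l == 1)%:R + (l == h.*2%:Z)%:R + (l == h.*2.+1%:Z)%:R.
Proof.
rewrite qbinS !qbin_order subr_eq0.
rewrite (_ : (l - 1 == h.*2%:Z) = (l == h.*2.+1%:Z)); last by lia.
rewrite mulrDr.
have -> : q ^ l * (l == 0)%:R = (l == 0)%:R :> K.
  by have [->|_] := eqVneq l 0; rewrite ?expr0z ?mulr1 ?mulr0.
have -> : q ^ l * (l == h.*2%:Z)%:R = (l == h.*2%:Z)%:R :> K.
  by have [->|_] := eqVneq l h.*2%:Z; rewrite ?mulr0 // -exprnP q_order mulr1.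
ring.
Qed.

(** The exponents in Schur's sums at the surviving indices are multiples of [h]
    up to a small remainder; an even multiple disappears and an odd one gives a
    sign. *)
Lemma exprz_even_mul (c e : int) : q ^ (2 * c * h%:Z + e) = q ^ e.
Proof.
rewrite expfzDr // (_ : 2 * c * h%:Z = h.*2%:Z * c); last first.
  by rewrite -muln2 PoszM; ring.
by rewrite -exprz_exp -exprnP q_order exp1rz mul1r.
Qed.

Lemma exprz_odd_mul (c e : int) : q ^ ((2 * c + 1) * h%:Z + e) = - q ^ e.
Proof.
rewrite (_ : _ + e = 2 * c * h%:Z + (h%:Z + e)); last by ring.
by rewrite exprz_even_mul expfzDr // -exprnP qh mulN1r.
Qed.

Ltac decide_indices := repeat match goal with
  |- context [@eq_op _ ?a ?b] =>
    first [rewrite (_ : (a == b) = false); last by lia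
          |rewrite (_ : (a == b) = true); last by lia] end.

Ltac simpl_indices :=
  decide_indices;
  rewrite /= ?(addr0, add0r, mulr0, mulr1, mul0r, mul1r, subr0, sub0r).

Lemma sum_pick2 N (F : int -> K) (i1 i2 : int) (v1 v2 : K) :
    - N%:Z <= i1 < N%:Z -> - N%:Z <= i2 < N%:Z ->
    (forall i, F i = (i == i1)%:R * v1 + (i == i2)%:R * v2) ->
  \sum_(0 <= k < N.*2) F (k%:Z - N%:Z) = v1 + v2.
Proof.
move=> i1N i2N Fi; rewrite -[v1 in RHS](@sum_pick N i1) //.
rewrite -[v2 in RHS](@sum_pick N i2) // -big_split /=.
by apply: eq_bigr => k _; rewrite Fi.
Qed.

(** In each sum the lower indices of the two binomials run over fixed residue
    classes modulo 5, while the binomials vanish except at the indices 0 and 2h,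
    and for the odd top index also 1 and 2h + 1.  Comparing residues leaves at
    most two nonzero terms. *)
Lemma schur_sums_5r3 r : h = (5 * r + 3)%N ->
  [/\ schur_even_sum 0 h h.+2 = 1,
      schur_odd_sum 0 h h.+2 = 1 + q ^ (- (2 * r%:Z + 1)),
      schur_even_sum 1 h h.+2 = q ^ (2 * r%:Z + 1) &
      schur_odd_sum 1 h h.+2 = q ^ (2 * r%:Z + 1)].
Proof.
move=> hr; have hz : h%:Z = 5 * r%:Z + 3 by lia.
have co1 : - q ^ schur_odd_exp 0 r = 1.
  have -> : schur_odd_exp 0 r = (2 * r%:Z + 1) * h%:Z + 0.
    by rewrite /schur_odd_exp hz; ring.
  by rewrite exprz_odd_mul opprK expr0z.
have co2 : - q ^ schur_odd_exp 0 (- r.+1%:Z) = q ^ (- (2 * r%:Z + 1)).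
  have -> : schur_odd_exp 0 (- r.+1%:Z) =
      (2 * r%:Z + 1) * h%:Z + (- (2 * r%:Z + 1)).
    by rewrite /schur_odd_exp hz intS; ring.
  by rewrite exprz_odd_mul opprK.
have co3 : - q ^ schur_odd_exp 1 (- r.+1%:Z) = q ^ (2 * r%:Z + 1).
  have -> : schur_odd_exp 1 (- r.+1%:Z) =
      (2 * r%:Z + 1) * h%:Z + (2 * r%:Z + 1).
    by rewrite /schur_odd_exp hz intS; ring.
  by rewrite exprz_odd_mul opprK.
split.
- rewrite -[RHS]addr0.
  apply: (@sum_pick2 _ (schur_even_term 0 h) r r) => [||i]; [lia|lia|].
  rewrite /schur_even_term !qbin_order.
  by have [->|ir] := eqVneq i r; simpl_indices;
    rewrite ?co1 ?co2 ?co3 ?oppr0.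
- apply: (@sum_pick2 _ (schur_odd_term 0 h) r (- r.+1%:Z)) => [||i]; [lia|lia|].
  rewrite /schur_odd_term !qbin_orderS.
  have [->|i1] := eqVneq i r; first by simpl_indices; rewrite ?co1 ?co2 ?co3 ?oppr0.
  by have [->|i2] := eqVneq i (- r.+1%:Z); simpl_indices;
    rewrite ?co1 ?co2 ?co3 ?oppr0.
- rewrite -[RHS]addr0.
  apply: (@sum_pick2 _ (schur_even_term 1 h) (- r.+1%:Z) r) => [||i]; [lia|lia|].
  rewrite /schur_even_term !qbin_order.
  by have [->|i1] := eqVneq i (- r.+1%:Z); simpl_indices;
    rewrite ?co1 ?co2 ?co3 ?oppr0.
- rewrite -[RHS]addr0.
  apply: (@sum_pick2 _ (schur_odd_term 1 h) (- r.+1%:Z) r) => [||i]; [lia|lia|].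
  rewrite /schur_odd_term !qbin_orderS.
  by have [->|i1] := eqVneq i (- r.+1%:Z); simpl_indices;
    rewrite ?co1 ?co2 ?co3 ?oppr0.
Qed.

Lemma schur_sums_5r1 r : h = (5 * r + 1)%N ->
  [/\ schur_even_sum 0 h h.+2 = 0,
      schur_odd_sum 0 h h.+2 = q ^ (- r%:Z),
      schur_even_sum 1 h h.+2 = q ^ r%:Z &
      schur_odd_sum 1 h h.+2 = q ^ r%:Z + 1].
Proof.
move=> hr; have hz : h%:Z = 5 * r%:Z + 1 by lia.
have ce1 : q ^ schur_even_exp 0 r = q ^ (- r%:Z).
  have -> : schur_even_exp 0 r = 2 * r%:Z * h%:Z + (- r%:Z).
    by rewrite /schur_even_exp hz; ring.
  by rewrite exprz_even_mul.
have ce2 : q ^ schur_even_exp 1 (- r%:Z) = q ^ r%:Z.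
  have -> : schur_even_exp 1 (- r%:Z) = 2 * r%:Z * h%:Z + r%:Z.
    by rewrite /schur_even_exp hz; ring.
  by rewrite exprz_even_mul.
have co1 : - q ^ schur_odd_exp 1 r = 1.
  have -> : schur_odd_exp 1 r = (2 * r%:Z + 1) * h%:Z + 0.
    by rewrite /schur_odd_exp hz; ring.
  by rewrite exprz_odd_mul opprK expr0z.
split.
- rewrite -[RHS]addr0.
  apply: (@sum_pick2 _ (schur_even_term 0 h) 0 0) => [||i]; [lia|lia|].
  by rewrite /schur_even_term !qbin_order; simpl_indices; rewrite oppr0.
- rewrite -[RHS]addr0.
  apply: (@sum_pick2 _ (schur_odd_term 0 h) r r) => [||i]; [lia|lia|].
  rewrite /schur_odd_term !qbin_orderS.
  by have [->|ir] := eqVneq i r; simpl_indices; rewrite ?ce1 ?ce2 ?co1 ?oppr0.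
- rewrite -[RHS]addr0.
  apply: (@sum_pick2 _ (schur_even_term 1 h) (- r%:Z) r) => [||i]; [lia|lia|].
  rewrite /schur_even_term !qbin_order.
  by have [->|i1] := eqVneq i (- r%:Z); simpl_indices;
    rewrite ?ce1 ?ce2 ?co1 ?oppr0.
- apply: (@sum_pick2 _ (schur_odd_term 1 h) (- r%:Z) r) => [||i]; [lia|lia|].
  rewrite /schur_odd_term !qbin_orderS.
  (* The two surviving summands share their index exactly when r = 0. *)
  have [r0|r0] := posnP r.
    have o0 : - q ^ schur_odd_exp 1 0%N = 1 by rewrite -co1 r0.
    rewrite r0; have [->|i1] := eqVneq i 0%N; simpl_indices; rewrite ?oppr0 //.
    by rewrite o0.
  have [->|i1] := eqVneq i (- r%:Z); first by simpl_indices; rewrite ce2.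
  by have [->|i2] := eqVneq i r; simpl_indices; rewrite ?co1 ?oppr0.
Qed.

End RootOfUnity.

End GaussianBinomial.

(** * Convergents over a period: Fibonacci numbers *)

Fixpoint fib (n : nat) : nat :=
  if n is (p.+1 as k).+1 then (fib k + fib p)%N else n.

Lemma fibSS n : fib n.+2 = (fib n.+1 + fib n)%N.
Proof. by []. Qed.

Lemma fib_gt0 n : (0 < fib n.+1)%N.
Proof. by elim: n => // n IH; rewrite fibSS addn_gt0 IH. Qed.

Section Period.
Variables (K : fieldType) (q : K) (u v w : nat -> K).
Hypotheses (u0 : u 0%N = 1) (u1 : u 1%N = 1) (v0 : v 0%N = 0) (v1 : v 1%N = 1).
Hypothesis uS : forall n, u n.+2 = u n.+1 + q ^+ n.+1 * u n.
Hypothesis vS : forall n, v n.+2 = v n.+1 + q ^+ n.+1 * v n.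

(** The recurrence is invariant under a shift by [m], hence the shifted sequence
    is a combination of the two basic solutions [u] and [v]; the coefficients
    are read off at the indices 0 and 1. *)
Lemma period_shift m n : q ^+ m = 1 ->
    (forall n, w n.+2 = w n.+1 + q ^+ n.+1 * w n) ->
  w (n + m)%N = w m * u n + (w m.+1 - w m) * v n.
Proof.
move=> qm wS.
suff: w (n + m)%N = w m * u n + (w m.+1 - w m) * v n /\
      w (n + m).+1 = w m * u n.+1 + (w m.+1 - w m) * v n.+1 by case.
elim: n => [|n [IH1 IH2]].
  by rewrite add0n u0 u1 v0 v1 !mulr1 mulr0 addr0 subrKC.
split; first by rewrite addSn.
rewrite addSn wS uS vS IH2 IH1 -addSn exprD qm mulr1; ring.
Qed.

End Period.

Section PeriodFib.
Variables (K : fieldType) (q : K) (u v : nat -> K) (g : K) (m : nat).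
Hypotheses (u0 : u 0%N = 1) (u1 : u 1%N = 1) (v0 : v 0%N = 0) (v1 : v 1%N = 1).
Hypothesis uS : forall n, u n.+2 = u n.+1 + q ^+ n.+1 * u n.
Hypothesis vS : forall n, v n.+2 = v n.+1 + q ^+ n.+1 * v n.
Hypotheses (qm : q ^+ m = 1) (g0 : g != 0).

Lemma period_fib_pm1 k :
    u m = 1 -> u m.+1 = 1 + g^-1 -> v m = g -> v m.+1 = g ->
  u (k * m)%N = (fib k.+1)%:R /\ v (k * m)%N = g * (fib k)%:R.
Proof.
move=> um um1 vm vm1; elim: k => [|k [IHu IHv]].
  by rewrite mul0n u0 v0 mulr0.
rewrite mulSnr !(period_shift u0 u1 v0 v1 uS vS _ qm) //.
rewrite um um1 vm vm1 IHu IHv fibSS natrD; split; last by ring.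
by field.
Qed.

Lemma period_fib_pm2 k :
    u m = 0 -> u m.+1 = g^-1 -> v m = g -> v m.+1 = g + 1 ->
  u (k.+1 * m)%N = (fib k)%:R /\ v (k.+1 * m)%N = g * (fib k.+1)%:R.
Proof.
move=> um um1 vm vm1; elim: k => [|k [IHu IHv]].
  by rewrite mul1n um vm mulr1.
rewrite mulSnr !(period_shift u0 u1 v0 v1 uS vS _ qm) //.
rewrite um um1 vm vm1 IHu IHv fibSS natrD; split; last by ring.
by field.
Qed.

End PeriodFib.

(** * Roots of unity and the convergents at them *)

Local Open Scope complex_scope.

Section Exp.
Variable R : realType.
Implicit Types t s : R.

Lemma exp2piiD t s : exp2pii (t + s) = exp2pii t * exp2pii s.
Proof.
rewrite /exp2pii mulrDr cosD sinD.
by apply/eqP; rewrite eq_complex /= eqxx addrC eqxx.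
Qed.

Lemma exp2pii0 : exp2pii (0 : R) = 1.
Proof. by rewrite /exp2pii mulr0 cos0 sin0. Qed.

Lemma exp2pii_neq0 t : exp2pii t != 0.
Proof.
apply/eqP => e; have := exp2piiD t (- t).
by rewrite subrr e mul0r exp2pii0 => /eqP; rewrite oner_eq0.
Qed.

Lemma exp2piiN t : exp2pii (- t) = (exp2pii t)^-1.
Proof.
apply: (mulIf (exp2pii_neq0 t)).
by rewrite mulVf ?exp2pii_neq0// -exp2piiD addNr exp2pii0.
Qed.

Lemma exp2piiX t n : exp2pii t ^+ n = exp2pii (n%:R * t).
Proof.
elim: n => [|n IH]; first by rewrite mul0r exp2pii0.
by rewrite exprSr IH -exp2piiD -natr1 mulrDl mul1r.
Qed.

Lemma exp2piiXz t (z : int) : exp2pii t ^ z = exp2pii (z%:~R * t).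
Proof.
case: z => n; first by rewrite -exprnP exp2piiX.
by rewrite NegzE -exprnN exp2piiX -exp2piiN intrN mulNr.
Qed.

Lemma exp2pii_half : exp2pii (2^-1 : R) = -1.
Proof.
rewrite /exp2pii mulrAC divff ?pnatr_eq0// mul1r cospi sinpi.
by apply/eqP; rewrite eq_complex /= oppr0 !eqxx.
Qed.

Lemma exp2pii_nat n : exp2pii (n%:R : R) = 1.
Proof.
have -> : (n%:R : R) = n.*2%:R * 2^-1.
  by rewrite -muln2 natrM mulfK // pnatr_eq0.
by rewrite -exp2piiX exp2pii_half -signr_odd odd_double.
Qed.

(** Halving the angle moves it into the range where the sine is positive. *)
Lemma exp2pii_neq1 t : 0 < t < 1 -> exp2pii t != 1.
Proof.
move=> /andP[t0 t1].
have -> : t = t / 2 + t / 2 by lra.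
rewrite exp2piiD -expr2 sqrf_eq1 negb_or /exp2pii !eq_complex /= oppr0.
have -> : 2 * pi * (t / 2) = pi * t by lra.
have : 0 < sin (pi * t).
  by apply: sin_gt0_pi; rewrite mulr_gt0 ?pi_gt0//= gtr_pMr ?pi_gt0.
by move=> /gt_eqF ->; rewrite !andbF.
Qed.

Lemma exp2pii_inj t s : 0 <= t < 1 -> 0 <= s < 1 ->
  exp2pii t = exp2pii s -> t = s.
Proof.
wlog ts : t s / t <= s.
  by move=> H t01 s01 e; case/orP: (le_total t s) => /H -> //.
move=> /andP[t0 t1] /andP[s0 s1] e; apply/eqP; rewrite eq_le ts /= leNgt.
apply/negP => lts; have : exp2pii (s - t) != 1.
  by apply: exp2pii_neq1; apply/andP; split; lra.
by rewrite exp2piiD exp2piiN e mulfV ?eqxx ?exp2pii_neq0.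
Qed.

Lemma turn_exp2pii t : 0 <= t < 1 -> turn (exp2pii t) = t.
Proof.
move=> t01; rewrite /turn.
case: xgetP => [s _ [s01 e]|/(_ t)]; first exact: exp2pii_inj.
by case; split.
Qed.

Lemma exp2pii_frac_eq1 (a m : nat) : (0 < m)%N ->
  exp2pii (a%:R / m%:R : R) = 1 -> (m %| a)%N.
Proof.
move=> m0; rewrite {1}(divn_eq a m) natrD natrM mulrDl mulfK ?pnatr_eq0 -?lt0n//.
rewrite exp2piiD exp2pii_nat mul1r; apply: contra_eqT => am; apply: exp2pii_neq1.
rewrite divr_gt0 ?ltr0n// ?lt0n// /=.
by rewrite ltr_pdivrMr ?ltr0n// mul1r ltr_nat ltn_mod.
Qed.

Lemma RR_exp2pii n t : 0 <= t < 1 -> RR n (exp2pii t) =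
  exp2pii (t / 5) * (Q_den n (exp2pii t) / P_num n (exp2pii t)).
Proof.
by move=> t01; rewrite /RR /fifth_root turn_exp2pii // /K_conv invf_div.
Qed.

(** The numerators and denominators with the index raised by one, so that the
    usual values P_(-1) = 1 and Q_(-1) = 0 become the initial terms.  Starting
    there makes the values along a period plain Fibonacci numbers. *)
Definition P_seq (x : R[i]) n := if n is k.+1 then @P_num R k x else 1.
Definition Q_seq (x : R[i]) n := if n is k.+1 then @Q_den R k x else 0.

Lemma P_numSS (x : R[i]) n : P_num n.+2 x = P_num n.+1 x + x ^+ n.+2 * P_num n x.
Proof. by rewrite /P_num /=; case: (num_pair n x). Qed.

Lemma Q_denSS (x : R[i]) n : Q_den n.+2 x = Q_den n.+1 x + x ^+ n.+2 * Q_den n x.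
Proof. by rewrite /Q_den /=; case: (den_pair n x). Qed.

Lemma P_seqSS x n : P_seq x n.+2 = P_seq x n.+1 + x ^+ n.+1 * P_seq x n.
Proof.
by case: n => [|n]; rewrite /P_seq ?P_numSS // /P_num /= mulr1 expr1.
Qed.

Lemma Q_seqSS x n : Q_seq x n.+2 = Q_seq x n.+1 + x ^+ n.+1 * Q_seq x n.
Proof.
by case: n => [|n]; rewrite /Q_seq ?Q_denSS // /Q_den /= mulr0 addr0.
Qed.

Section RootOfUnityConvergents.
Variables (h c : nat).
Hypotheses (h0 : (0 < h)%N) (c_odd : odd c).
Hypotheses (cm : coprime c h.*2) (c_lt : (c < h.*2)%N).

Let t : R := c%:R / h.*2%:R.
Let x : R[i] := exp2pii t.

Let m_neq0 : h.*2%:R != 0 :> R.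
Proof. by rewrite pnatr_eq0; lia. Qed.

Let t01 : 0 <= t < 1.
Proof.
rewrite divr_ge0 ?ler0n //= ltr_pdivrMr ?ltr0n; last by lia.
by rewrite mul1r ltr_nat.
Qed.

Let xh : x ^+ h = -1.
Proof.
rewrite exp2piiX; have -> : h%:R * t = c%:R * 2^-1.
  have h_neq0 : h%:R != 0 :> R by rewrite pnatr_eq0; lia.
  by rewrite /t -muln2 natrM; field.
by rewrite -exp2piiX exp2pii_half -signr_odd c_odd.
Qed.

Let x_prim l : (0 < l < h.*2)%N -> x ^+ l != 1.
Proof.
move=> /andP[l0 lm]; apply/eqP; rewrite exp2piiX mulrA -natrM.
move=> /(exp2pii_frac_eq1 (ltn_trans l0 lm)).
by rewrite Gauss_dvdl 1?coprime_sym // => /(dvdn_leq l0); lia.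
Qed.

(** Here [h.*2 = 10 * r + 6], so that c/(5m) + (2r+1) c/m = c/5 for m = [h.*2]:
    the power of the root of unity coming from Schur's sums absorbs the part of
    the fifth root that depends on m. *)
Lemma RR_root_5r3 r k : h = (5 * r + 3)%N ->
  P_num (k.+1 * h.*2).-1 x = (fib k.+2)%:R /\
  RR (k.+1 * h.*2).-1 x =
    exp2pii (c%:R / 5) * ((fib k.+1)%:R / (fib k.+2)%:R).
Proof.
move=> hr; have x0 : x != 0 := exp2pii_neq0 t.
have [De Do Ee Eo] := schur_sums_5r3 x0 h0 xh x_prim hr.
have [D1 D2] :=
    schur_identity (s := 0) (u := P_seq x) (h := h) x0 isT
      erefl erefl (P_seqSS x) (leqnSn _).
have [E1 E2] :=
    schur_identity (s := 1) (u := Q_seq x) (h := h) x0 isT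
      erefl erefl (Q_seqSS x) (leqnSn _).
have xm : x ^+ h.*2 = 1 := q_order xh.
have [|||||Pk Qk] := @period_fib_pm1 _ x (P_seq x) (Q_seq x) (x ^ (2 * r%:Z + 1))
  h.*2 erefl erefl erefl erefl (P_seqSS x) (Q_seqSS x) xm _ k.+1.
- by rewrite expfz_neq0.
- by rewrite D1.
- by rewrite D2 Do invr_expz.
- by rewrite E1.
- by rewrite E2.
have nE : (k.+1 * h.*2)%N = (k.+1 * h.*2).-1.+1 by lia.
rewrite nE /= in Pk Qk; split=> //.
rewrite RR_exp2pii // Pk Qk !mulrA; congr (_ * _ / _).
rewrite /x exp2piiXz -exp2piiD; congr exp2pii.
have mE : h.*2%:R = 10 * r%:R + 6 :> R by rewrite hr -mul2n natrM natrD natrM; ring.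
have m0 := m_neq0; rewrite mE in m0.
by rewrite /t mE; field.
Qed.

(** Here [h.*2 = 10 * r + 2], so that c/(5m) + r c/m = c/10 for m = [h.*2]. *)
Lemma RR_root_5r1 r k : h = (5 * r + 1)%N ->
  P_num (k.+2 * h.*2).-1 x = (fib k.+1)%:R /\
  RR (k.+2 * h.*2).-1 x =
    exp2pii (c%:R / 10) * ((fib k.+2)%:R / (fib k.+1)%:R).
Proof.
move=> hr; have x0 : x != 0 := exp2pii_neq0 t.
have [De Do Ee Eo] := schur_sums_5r1 x0 h0 xh x_prim hr.
have [D1 D2] :=
    schur_identity (s := 0) (u := P_seq x) (h := h) x0 isT
      erefl erefl (P_seqSS x) (leqnSn _).
have [E1 E2] :=
    schur_identity (s := 1) (u := Q_seq x) (h := h) x0 isT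
      erefl erefl (Q_seqSS x) (leqnSn _).
have xm : x ^+ h.*2 = 1 := q_order xh.
have [|||||Pk Qk] := @period_fib_pm2 _ x (P_seq x) (Q_seq x) (x ^ r%:Z)
  h.*2 erefl erefl erefl erefl (P_seqSS x) (Q_seqSS x) xm _ k.+1.
- by rewrite expfz_neq0.
- by rewrite D1.
- by rewrite D2 Do invr_expz.
- by rewrite E1.
- by rewrite E2.
have nE : (k.+2 * h.*2)%N = (k.+2 * h.*2).-1.+1 by lia.
rewrite nE /= in Pk Qk; split=> //.
rewrite RR_exp2pii // Pk Qk !mulrA; congr (_ * _ / _).
rewrite /x exp2piiXz -exp2piiD; congr exp2pii.
have mE : h.*2%:R = 10 * r%:R + 2 :> R by rewrite hr -mul2n natrM natrD natrM; ring.
have m0 := m_neq0; rewrite mE in m0.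
by rewrite /t mE; field.
Qed.

End RootOfUnityConvergents.

End Exp.

(** * Ratios of Fibonacci numbers *)

Section GoldenRatio.
Variable R : realType.

Lemma phi_bounds : 3 / 2 < phi R < 2.
Proof.
have s5 : Num.sqrt (5 : R) ^+ 2 = 5 by rewrite sqr_sqrtr ?ler0n.
have s0 : 0 <= Num.sqrt (5 : R) := sqrtr_ge0 _.
by rewrite /phi; apply/andP; split; nra.
Qed.

Lemma phi_sqr : phi R ^+ 2 = phi R + 1.
Proof.
have s5 : Num.sqrt (5 : R) ^+ 2 = 5 by rewrite sqr_sqrtr ?ler0n.
by rewrite /phi; nra.
Qed.

(** Both sides have ratio [1 - phi], the conjugate root of z^2 = z + 1. *)
Lemma fib_phi n : (fib n.+1)%:R - phi R * (fib n)%:R = (1 - phi R) ^+ n.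
Proof.
elim: n => [|n IH]; first by rewrite mulr0 subr0.
rewrite fibSS natrD exprSr -IH; apply/eqP; rewrite -subr_eq0; apply/eqP.
transitivity ((fib n)%:R * (phi R + 1 - phi R ^+ 2)); first by ring.
by rewrite phi_sqr subrr mulr0.
Qed.

Lemma fib_ratio n :
  `|(fib n.+2)%:R / (fib n.+1)%:R - phi R| <= `|1 - phi R| ^+ n.+1.
Proof.
have f1 : 1 <= (fib n.+1)%:R :> R by rewrite ler1n fib_gt0.
have f0 : (fib n.+1)%:R != 0 :> R by rewrite pnatr_eq0 -lt0n fib_gt0.
have -> : (fib n.+2)%:R / (fib n.+1)%:R - phi R =
    (1 - phi R) ^+ n.+1 / (fib n.+1)%:R by rewrite -fib_phi; field.
rewrite normrM normrX ler_piMr ?exprn_ge0 // normfV ger0_norm ?ler0n //.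
by rewrite invf_le1 // (lt_le_trans ltr01).
Qed.

Lemma fib_ratioV n :
  `|(fib n.+1)%:R / (fib n.+2)%:R - (phi R)^-1| <= `|1 - phi R| ^+ n.+1.
Proof.
have [p1 p2] := andP phi_bounds.
have f1 : 1 <= (fib n.+2)%:R :> R by rewrite ler1n fib_gt0.
have f0 : (fib n.+2)%:R != 0 :> R by rewrite pnatr_eq0 -lt0n fib_gt0.
have p0 : phi R != 0 by lra.
have -> : (fib n.+1)%:R / (fib n.+2)%:R - (phi R)^-1 =
    - ((1 - phi R) ^+ n.+1) / (phi R * (fib n.+2)%:R).
  by rewrite -fib_phi; field; rewrite f0 p0.
rewrite normrM normrN normrX ler_piMr ?exprn_ge0 // normfV ger0_norm; last nra.
by rewrite invf_le1; nra.
Qed.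

Lemma one_sub_phi_expr_small (e : R) : 0 < e -> exists n, `|1 - phi R| ^+ n.+1 < e.
Proof.
move=> e0; have psi1 : `| `|1 - phi R| | < 1.
  have := phi_bounds; rewrite normr_id ltr_norml; lra.
have /cvgrPdist_lt /(_ e e0)[N _ H] := cvg_expr psi1.
exists N; have := H N.+1 (leqnSn N).
by rewrite /= sub0r normrN normrX !normr_id.
Qed.

End GoldenRatio.

(** * Convergents near the limits, on a dense set of turns *)

Section ComplexContinuity.
Variable R : realType.
Implicit Types t s : R.

Lemma norm_real_complex (x : R) : `|x%:C| = `|x|%:C.
Proof. by rewrite normc_def /= expr0n addr0 sqrtr_sqr. Qed.

Lemma norm_exp2pii t : `|exp2pii t| = 1.
Proof. by rewrite normc_def /= cos2Dsin2 sqrtr1. Qed.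

Lemma gt0_complexE (e : R[i]) : 0 < e -> exists2 e' : R, 0 < e' & e = e'%:C.
Proof. by case: e => a b; rewrite ltcE /= => /andP[/eqP -> a0]; exists a. Qed.

Lemma real_complex_continuous : continuous (fun t : R => t%:C : R[i]^o).
Proof.
move=> t; apply/cvgrPdist_lt => e /gt0_complexE [e' e0 ->].
near=> s; rewrite -raddfB /= norm_real_complex ltcR.
near: s; exact: (@cvgr_dist_lt _ _ _ _ _ (fun s => s) t).
Unshelve. all: by end_near. Qed.

Lemma exp2pii_continuous : continuous (fun t : R => exp2pii t : R[i]^o).
Proof.
have -> : (fun t => exp2pii t : R[i]^o) =
   (fun t => (cos (2 * pi * t))%:C + 'i%C * (sin (2 * pi * t))%:C).
  by apply/funext => t; rewrite [LHS]complexE.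
have lin : continuous (fun t : R => 2 * pi * t) by exact: mulrl_continuous.
move=> t; apply: cvgD.
  apply: (@continuous_comp _ _ _ (fun t => cos (2 * pi * t)) _ t).
    by apply: (continuous_comp (lin t)); exact: continuous_cos.
  exact: real_complex_continuous.
apply: cvgMr.
apply: (@continuous_comp _ _ _ (fun t => sin (2 * pi * t)) _ t).
  by apply: (continuous_comp (lin t)); exact: continuous_sin.
exact: real_complex_continuous.
Qed.

Lemma exp2piiM_continuous a : continuous (fun t : R => exp2pii (a * t) : R[i]^o).
Proof.
move=> t; apply: (continuous_comp (@mulrl_continuous _ a t)).
exact: exp2pii_continuous.
Qed.

Lemma P_num_continuous n : continuous (fun t : R => P_num n (exp2pii t) : R[i]^o).
Proof.
suff [] : continuous (fun t : R => P_num n (exp2pii t) : R[i]^o) /\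
  continuous (fun t : R => P_num n.+1 (exp2pii t) : R[i]^o) by [].
elim: n => [|n [IH1 IH2]].
  split; first by move=> t; exact: cvg_cst.
  by move=> t; apply: cvgD; [exact: cvg_cst|exact: exp2pii_continuous].
split; first exact: IH2.
rewrite (_ : (fun t => _) = (fun t => P_num n.+1 (exp2pii t)
    + exp2pii (n.+2%:R * t) * P_num n (exp2pii t))).
  move=> t; apply: cvgD; first exact: IH2.
  by apply: cvgM; [exact: exp2piiM_continuous|exact: IH1].
by apply/funext => t; rewrite P_numSS exp2piiX.
Qed.

Lemma Q_den_continuous n : continuous (fun t : R => Q_den n (exp2pii t) : R[i]^o).
Proof.
suff [] : continuous (fun t : R => Q_den n (exp2pii t) : R[i]^o) /\
  continuous (fun t : R => Q_den n.+1 (exp2pii t) : R[i]^o) by [].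
elim: n => [|n [IH1 IH2]].
  by split; move=> t; exact: cvg_cst.
split; first exact: IH2.
rewrite (_ : (fun t => _) = (fun t => Q_den n.+1 (exp2pii t)
    + exp2pii (n.+2%:R * t) * Q_den n (exp2pii t))).
  move=> t; apply: cvgD; first exact: IH2.
  by apply: cvgM; [exact: exp2piiM_continuous|exact: IH1].
by apply/funext => t; rewrite Q_denSS exp2piiX.
Qed.

Lemma RR_near n t (l e : R[i]) : 0 < t < 1 -> P_num n (exp2pii t) != 0 ->
  `|RR n (exp2pii t) - l| < e -> \forall s \near t, `|RR n (exp2pii s) - l| < e.
Proof.
move=> t01 Pt0.
pose f s : R[i]^o :=
  exp2pii (5^-1 * s) * (Q_den n (exp2pii s) / P_num n (exp2pii s)).
have fE s : 0 < s < 1 -> RR n (exp2pii s) = f s.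
  by move=> /andP[s0 s1]; rewrite RR_exp2pii ?(ltW s0) // /f [s / 5]mulrC.
have fc : (f s - (l : R[i]^o)) @[s --> t] --> f t - (l : R[i]^o).
  apply: cvgB; last exact: cvg_cst.
  apply: cvgM; first exact: exp2piiM_continuous.
  apply: cvgM; first exact: Q_den_continuous.
  by apply: cvgV => //; exact: P_num_continuous.
rewrite fE // => fe; near=> s.
rewrite fE; last first.
  apply/andP; split; near: s.
    by apply: lt_nbhsr; case/andP: t01.
  by apply: lt_nbhsl; case/andP: t01.
near: s; exact: (cvgr_norm_lt _ fc _ fe).
Unshelve. all: by end_near. Qed.

(** Fractions with denominator [m] and numerators in a class modulo 10 form a
    progression of step 10/m. *)
Lemma frac_dense (b : nat) (x y : R) : 0 <= x < y -> exists M : nat,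
  forall m, (M <= m)%N -> exists a : nat, x < (10 * a + b)%:R / m%:R < y.
Proof.
move=> /andP[x0 xy]; pose z := (x + y) / 2.
pose B := b%:R / z + 10 / (y - z).
have z0 : 0 < z by rewrite /z; lra.
have yz : 0 < y - z by rewrite /z; lra.
have B1 : 0 <= b%:R / z by rewrite divr_ge0 ?ler0n // ltW.
have B2 : 0 <= 10 / (y - z) by rewrite divr_ge0 // ltW.
exists (Num.truncn B).+1 => m Mm.
have Bm : B < m%:R.
  by apply: lt_le_trans (truncnS_gt _) _; rewrite ler_nat.
have m0 : 0 < m%:R :> R by apply: le_lt_trans Bm; rewrite addr_ge0.
have bm : b%:R < z * m%:R by rewrite mulrC -ltr_pdivrMr //; rewrite /B in Bm; lra.
have ym : 10 < (y - z) * m%:R.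
  by rewrite mulrC -ltr_pdivrMr //; rewrite /B in Bm; lra.
pose w := (z * m%:R - b%:R) / 10.
have w0 : 0 <= w by rewrite /w; lra.
exists (Num.truncn w).+1.
have /andP[w1 w2] := truncn_itv w0.
rewrite natrD natrM -[(Num.truncn w).+1%:R]natr1 in w2 *.
rewrite ltr_pdivlMr // ltr_pdivrMr //.
have xz : x * m%:R < z * m%:R by rewrite ltr_pM2r // /z; lra.
rewrite /w in w1 w2; apply/andP; split; lra.
Qed.

(** The sign of R_j is the half turn contained in c/10 when c is odd. *)
Lemma RR_limit_lo j a : (j <= 5)%N ->
  RR_limit R j = (phi R)%:C * exp2pii ((10 * a + (2 * j + 5))%:R / 10).
Proof.
move=> j5; rewrite /RR_limit j5 mulNr -mulrN; congr (_ * _).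
have -> : (10 * a + (2 * j + 5))%:R / 10 = a%:R + j%:R / 5 + 2^-1 :> R.
  by rewrite natrD natrM (natrD _ (2 * j)) natrM; field.
by rewrite !exp2piiD exp2pii_half exp2pii_nat; ring.
Qed.

(** The odd numbers congruent to [j] modulo 5 are those congruent to [6 * j + 5]
    modulo 10. *)
Lemma RR_limit_hi j a : (5 < j)%N ->
  RR_limit R j = exp2pii ((10 * a + (6 * j + 5))%:R / 5) / (phi R)%:C.
Proof.
rewrite ltnNge => /negbTE j5; rewrite /RR_limit j5; congr (_ / _).
have -> : (10 * a + (6 * j + 5))%:R / 5 =
    a%:R + a%:R + j%:R + 1%:R + j%:R / 5 :> R.
  by rewrite natrD natrM (natrD _ (6 * j)) natrM; field.
by rewrite !exp2piiD !exp2pii_nat !mul1r.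
Qed.

(** Powers of 16 are 1 modulo 5, which puts the orders 2 * 16^M and 16^(M+1)
    in the two classes where the convergents are known; odd numerators are prime
    to these orders. *)
Lemma RR_dense j x y (e : R) : 0 <= x < y -> y <= 1 -> 0 < e -> exists t n,
  [/\ x < t < y, (0 < n)%N, P_num n (exp2pii t) != 0 &
      `|RR n (exp2pii t) - RR_limit R j| < e%:C].
Proof.
move=> xy y1 e0; have [k ke] := one_sub_phi_expr_small e0.
have fib_n0 n : (fib n.+1)%:R != 0 :> R[i] by rewrite pnatr_eq0 -lt0n fib_gt0.
have coprime_odd_pow c n : odd c -> coprime c (16 ^ n).
  by move=> c_odd; rewrite coprimeXr // -[16%N]/(2 ^ 4)%N coprimeXr ?coprimen2.
have lt1 c m : x < c%:R / m%:R < y -> (0 < m)%N -> (0 < c < m)%N.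
  move=> /andP[xc cy] m0; have m0' : 0 < m%:R :> R by rewrite ltr0n.
  apply/andP; split.
    rewrite lt0n; apply: contraTneq xc => ->; rewrite mul0r -leNgt; lra.
  have : c%:R / m%:R < 1 :> R by lra.
  by rewrite ltr_pdivrMr // mul1r ltr_nat.
have dist (z : R[i]) (u v : R) : `|z| = 1 -> `|u - v| <= `|1 - phi R| ^+ k.+1 ->
    `|z * u%:C - z * v%:C| < e%:C.
  move=> z1 uv; rewrite -mulrBr -raddfB normrM z1 mul1r norm_real_complex ltcR.
  exact: le_lt_trans ke.
case: (leqP j 5) => j5.
- have [M HM] := frac_dense (2 * j + 5) xy.
  pose h := (16 ^ M)%N.
  have Mh : (M < h)%N by rewrite ltn_expl.
  have h1 : h = (5 * (h %/ 5) + 1)%N.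
    by rewrite {1}(divn_eq h 5) mulnC -modnXm exp1n.
  have [a ha] := HM h.*2 ltac:(lia); set c := (10 * a + _)%N in ha.
  have h0 : (0 < h)%N by lia.
  have /andP[c0 ch] := lt1 _ _ ha ltac:(lia).
  have c_odd : odd c by rewrite /c; lia.
  have cm : coprime c h.*2.
    by rewrite -muln2 coprimeMr coprimen2 c_odd coprime_odd_pow.
  have [Pn Rn] := RR_root_5r1 R h0 c_odd cm ch k h1.
  exists (c%:R / h.*2%:R), (k.+2 * h.*2).-1; split=> //; first by lia.
    by rewrite Pn.
  rewrite Rn (RR_limit_lo a j5) -/c [(phi R)%:C * _]mulrC.
  rewrite -!(rmorph_nat (real_complex R)) -fmorphV -rmorphM.
  by apply: dist; [exact: norm_exp2pii|exact: fib_ratio].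
- have [M HM] := frac_dense (6 * j + 5) xy.
  pose h := (8 * 16 ^ M)%N.
  have Mh : (M < h)%N by rewrite /h; have := ltn_expl M (isT : (1 < 16)%N); lia.
  have h1 : h = (5 * (h %/ 5) + 3)%N.
    by rewrite {1}(divn_eq h 5) mulnC -modnMmr -modnXm exp1n.
  have [a ha] := HM h.*2 ltac:(lia); set c := (10 * a + _)%N in ha.
  have h0 : (0 < h)%N by lia.
  have /andP[c0 ch] := lt1 _ _ ha ltac:(lia).
  have c_odd : odd c by rewrite /c; lia.
  have cm : coprime c h.*2.
    rewrite -muln2 !coprimeMr coprimen2 c_odd coprime_odd_pow // !andbT.
    by rewrite -[8%N]/(2 ^ 3)%N coprimeXr ?coprimen2.
  have [Pn Rn] := RR_root_5r3 R h0 c_odd cm ch k h1.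
  exists (c%:R / h.*2%:R), (k.+1 * h.*2).-1; split=> //; first by lia.
    by rewrite Pn.
  rewrite Rn (RR_limit_hi a j5) -/c.
  rewrite -!(rmorph_nat (real_complex R)) -!fmorphV -rmorphM.
  by apply: dist; [exact: norm_exp2pii|exact: fib_ratioV].
Qed.

End ComplexContinuity.

(** * Large partial quotients near rational numbers *)

Section Cylinders.
Variable R : realType.
Implicit Types (w : seq nat) (y t : R).

Definition cf_eval w y : R := foldr (fun a s => (a%:R + s)^-1) y w.

Lemma cf_eval_cat w1 w2 y : cf_eval (w1 ++ w2) y = cf_eval w1 (cf_eval w2 y).
Proof. by rewrite /cf_eval foldr_cat. Qed.

Lemma inv_shift_itv (a : nat) y : (0 < a)%N -> 0 < y < 1 ->
  0 < (a%:R + y)^-1 < 1.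
Proof.
move=> a0 /andP[y0 y1]; have a1 : 1 <= a%:R :> R by rewrite ler1n.
by rewrite invr_gt0 invf_lt1 ?addr_gt0 ?ltr0n //=; lra.
Qed.

Lemma cf_eval_itv w y : all (ltn 0) w -> 0 < y < 1 -> 0 < cf_eval w y < 1.
Proof.
move=> + y01; elim: w => //= a w IH /andP[a0 /IH w01].
exact: inv_shift_itv.
Qed.

Lemma truncn_shift (a : nat) y : 0 < y < 1 -> Num.truncn (a%:R + y) = a.
Proof.
move=> /andP[y0 y1]; apply: truncn_def.
by rewrite -natr1; apply/andP; split; lra.
Qed.

Lemma gauss_map_inv (a : nat) y : 0 < y < 1 -> gauss_map (a%:R + y)^-1 = y.
Proof. by move=> y01; rewrite /gauss_map invrK truncn_shift // addrC addKr. Qed.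

Lemma partial_quotient_cons (a : nat) y k : 0 < y < 1 ->
  partial_quotient (a%:R + y)^-1 k.+2 = partial_quotient y k.+1.
Proof. by move=> y01; rewrite /partial_quotient iterSr gauss_map_inv. Qed.

Lemma partial_quotient_cf_eval w y k : all (ltn 0) w -> 0 < y < 1 ->
  partial_quotient (cf_eval w y) k.+1 =
  if (k < size w)%N then nth 0%N w k else partial_quotient y (k - size w).+1.
Proof.
move=> + y01; elim: w k => [|a w IH] k; first by rewrite subn0.
move=> /= /andP[a0 w0]; have w01 := cf_eval_itv w0 y01.
case: k => [|k]; first by rewrite /= invrK truncn_shift.
by rewrite [LHS](partial_quotient_cons a k w01) IH.
Qed.

(** The leading 0 is the integer part of a number in (0,1). *)
Definition cf_rat w : rat := foldr (fun a q => a%:R + q^-1) 0 (0%N :: w).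

Lemma cf_convergent_cf_eval w y : all (ltn 0) w -> 0 < y < 1 ->
  cf_convergent (cf_eval w y) (size w) = cf_rat w.
Proof.
move=> w0 y01; rewrite /cf_convergent /cf_rat.
congr foldr; rewrite [iota _ _]/= map_cons; congr cons.
apply: (@eq_from_nth _ 0%N); first by rewrite size_map size_iota.
move=> i; rewrite size_map size_iota => iw.
rewrite (nth_map 0%N) ?size_iota // nth_iota // add1n.
by rewrite partial_quotient_cf_eval // iw.
Qed.

(** Each map sending y to 1/(a + y) is a decreasing bijection between intervals,
    so the numbers with a prescribed beginning and a remainder in an interval
    fill an interval. *)
Lemma cf_eval_interval w u v : 0 <= u < v -> v <= 1 -> all (ltn 0) w ->
  exists u' v', [/\ 0 <= u', u' < v', v' <= 1 &
    forall t, u' < t < v' -> exists2 y, u < y < v & t = cf_eval w y].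
Proof.
move=> uv v1; elim: w => [|a w IH] /=.
  by move: uv => /andP[u0 uv] _; exists u, v; split=> // t ?; exists t.
move=> /andP[a0 /IH [u' [v' [u0 uv' v1' H]]]].
have a1 : 1 <= a%:R :> R by rewrite ler1n.
exists (a%:R + v')^-1, (a%:R + u')^-1; split.
- by rewrite invr_ge0; lra.
- by rewrite ltf_pV2 ?posrE; lra.
- by rewrite invf_le1; lra.
move=> t /andP[t1 t2].
have t0 : 0 < t by apply: lt_trans t1; rewrite invr_gt0; lra.
have [] := H (t^-1 - a%:R); last first.
  by move=> y uyv e; exists y => //; rewrite -e subrKC invrK.
rewrite ltrBrDl ltrBlDl; apply/andP; split.
  by rewrite -[ltLHS]invrK ltf_pV2 ?posrE // invr_gt0; lra.
by rewrite -[ltRHS]invrK ltf_pV2 ?posrE // invr_gt0; lra.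
Qed.

Lemma inv_shift_between (a : nat) (u v s : R) : 0 < u -> 0 < v -> 0 < a%:R + s ->
  v^-1 - a%:R < s < u^-1 - a%:R -> u < (a%:R + s)^-1 < v.
Proof.
move=> u0 v0 s0; rewrite ltrBlDl ltrBrDl => /andP[sv su].
apply/andP; split.
  by rewrite -[ltLHS]invrK ltf_pV2 ?posrE ?invr_gt0.
by rewrite -[ltRHS]invrK ltf_pV2 ?posrE ?invr_gt0.
Qed.

(** Words of any prescribed length are needed because S asks for infinitely many
    ranks.  One letter is gained by inverting the interval and keeping the part
    of it between two consecutive integers. *)
Lemma cf_eval_deep N (x y : R) : 0 <= x < y -> y <= 1 ->
  exists w u v, [/\ size w = N, all (ltn 0) w, 0 <= u < v, v <= 1 &
    forall s, u < s < v -> x < cf_eval w s < y].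
Proof.
elim: N x y => [|N IH] x y xy y1; first by exists [::], x, y.
have [x0 lexy] := andP xy.
(* The left end may be 0, which has no inverse; the midpoint replaces it. *)
pose z := (x + y) / 2; have z0 : 0 < z by rewrite /z; lra.
have zy : z < y by rewrite /z; lra.
have y0 : 0 < y by lra.
have y1V : 1 <= y^-1 by rewrite invf_ge1.
have yzV : y^-1 < z^-1 by rewrite ltf_pV2.
have /andP[a1 a2] := truncn_itv (ltW (lt_le_trans ltr01 y1V)).
set a := Num.truncn _ in a1 a2; rewrite -natr1 in a2.
have a0 : (0 < a)%N by rewrite /a truncn_gt0.
have a0' : 1 <= a%:R :> R by rewrite ler1n.
have [||w [u [v [wN w0 uv v1 H]]]] :=
  IH (y^-1 - a%:R) (Num.min (z^-1 - a%:R) 1).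
- by rewrite lt_min; apply/andP; split; [lra|apply/andP; split; lra].
- by rewrite ge_min lexx orbT.
exists (a :: w), u, v; split=> //=; rewrite ?wN ?a0 //.
move=> s /H; rewrite lt_min => /andP[s1 /andP[s2 s3]].
have /andP[] : z < (a%:R + cf_eval w s)^-1 < y.
  by apply: inv_shift_between => //; [lra|rewrite s1 s2].
by move=> zs ->; rewrite andbT; apply: le_lt_trans zs; rewrite /z; lra.
Qed.

(** Euclid's algorithm on p/q produces the word; it stops at an integer, where
    the remainder is 0, and small positive remainders stay in the interval. *)
Lemma cf_eval_near_rational (p q : nat) (x y : R) : (0 < p < q)%N -> 0 < x ->
  x < p%:R / q%:R < y ->
  exists w d, [/\ all (ltn 0) w, 0 < d &
    forall s, 0 < s < d -> x < cf_eval w s < y].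
Proof.
have [n] := ubnP p; elim: n p q x y => // n IH p q x y pn /andP[p0 pq] x0.
move=> /andP[xpq pqy].
have P0 : 0 < p%:R :> R by rewrite ltr0n.
have Q0 : 0 < q%:R :> R by rewrite ltr0n; lia.
have PQ0 : 0 < p%:R / q%:R :> R by rewrite divr_gt0.
have y0 : 0 < y by lra.
have [xV yV] : q%:R / p%:R < x^-1 /\ y^-1 < q%:R / p%:R.
  by rewrite -[q%:R / p%:R]invf_div !ltf_pV2 ?posrE.
have qE : q%:R / p%:R = (q %/ p)%:R + (q %% p)%:R / p%:R :> R.
  by rewrite {1}(divn_eq q p) natrD natrM; field; lra.
have a0 : (0 < q %/ p)%N by rewrite divn_gt0 //; lia.
set a := (q %/ p)%N in qE a0; set r := (q %% p)%N in qE.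
have a1 : 1 <= a%:R :> R by rewrite ler1n.
have [r0|r0] := posnP r.
  exists [:: a], (x^-1 - a%:R); rewrite r0 mul0r addr0 in qE; split=> /=.
  - by rewrite a0.
  - lra.
  by move=> s s01; apply: inv_shift_between => //; lra.
have R0 : 0 < r%:R / p%:R :> R by rewrite divr_gt0 ?ltr0n.
have rp : (r < p)%N by rewrite ltn_mod.
have [||||w [d [w0 d0 H]]] := IH r p (Num.max (r%:R / p%:R / 2) (y^-1 - a%:R))
  (x^-1 - a%:R).
- by apply: leq_trans rp _.
- by rewrite r0.
- by rewrite lt_max; apply/orP; left; lra.
- by rewrite gt_max; apply/andP; split; [apply/andP; split|]; lra.
exists (a :: w), d; split=> //=; first by rewrite a0.
move=> s /H; rewrite gt_max => /andP[/andP[s1 s2] s3].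
by apply: inv_shift_between => //; lra.
Qed.

(** The word has a first part that reaches rank [N] and a second part that leads
    to a rational number of the interval; the remainder is then taken small
    against the denominator that the whole word determines. *)
Lemma large_quotient_dense N (x y : R) : 0 <= x < y -> y <= 1 ->
  exists x' y', x' < y' /\ forall t, x' < t < y' -> x < t < y /\
    exists i, (N <= i)%N /\
      phi R ^+ cf_denominator t i <= (partial_quotient t i.+1)%:R.
Proof.
move=> xy y1; have [w1 [u [v [w1N w10 uv v1 H1]]]] := cf_eval_deep N xy y1.
have [u0 ltuv] := andP uv.
have um : u < (u + v) / 2 by lra.
have : (u + v) / 2 < v by lra.
move=> /rat_in_itvoo [r]; rewrite in_itv /= => /andP[r1 r2].
have r0 : 0 < r by rewrite -(ltr0q R); lra.
have rE : ratr r = `|numq r|%N%:R / `|denq r|%N%:R :> R.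
  have nE : `|numq r|%N%:R = (numq r)%:~R :> R.
    by rewrite pmulrn gez0_abs // numq_ge0 ltW.
  have dE : `|denq r|%N%:R = (denq r)%:~R :> R by rewrite pmulrn absz_denq.
  by rewrite nE dE.
have [|||w2 [d [w20 d0 H2]]] := @cf_eval_near_rational `|numq r| `|denq r|
  ((u + v) / 2) v.
- rewrite absz_gt0 numq_eq0 gt_eqF //=.
  have : ratr r < 1 :> R by lra.
  by rewrite rE ltr_pdivrMr ?mul1r ?ltr_nat // ltr0n absz_gt0 denq_neq0.
- lra.
- by rewrite -rE r1 r2.
have w0 : all (ltn 0) (w1 ++ w2) by rewrite all_cat w10.
pose e := (phi R ^+ `|denq (cf_rat (w1 ++ w2))| + 1)^-1.
have ph0 : 0 <= phi R by rewrite /phi divr_ge0 // addr_ge0 ?sqrtr_ge0.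
have e1 : 1 <= phi R ^+ `|denq (cf_rat (w1 ++ w2))| + 1.
  by rewrite lerDr exprn_ge0.
have e0 : 0 < e by rewrite invr_gt0 (lt_le_trans ltr01).
have le1 : e <= 1 by rewrite invf_le1 // (lt_le_trans ltr01).
have [||x' [y' [_ xy' _ H]]] := @cf_eval_interval (w1 ++ w2) 0 (Num.min d e) _ _ w0.
- by rewrite lexx lt_min d0.
- by rewrite ge_min le1 orbT.
exists x', y'; split; [exact: xy'|move=> t /H [s /andP[s0]]].
rewrite lt_min => /andP[sd se] ->.
have s1 : 0 < s < 1 by rewrite s0 (lt_le_trans se).
split.
  rewrite cf_eval_cat; apply: H1.
  have /H2 : 0 < s < d by rewrite s0.
  by move=> /andP[us ->]; rewrite andbT (lt_trans um).
exists (size (w1 ++ w2)); split; [by rewrite size_cat w1N leq_addr|].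
have pqE : partial_quotient (cf_eval (w1 ++ w2) s) (size (w1 ++ w2)).+1 =
    Num.truncn s^-1.
  by rewrite partial_quotient_cf_eval // ltnn subnn.
rewrite [X in _ <= X%:R]pqE /cf_denominator cf_convergent_cf_eval //.
have se' : e^-1 < s^-1 by rewrite ltf_pV2.
rewrite /e invrK in se'.
by apply: ltW; rewrite -(ltrD2r 1) natr1 (lt_trans se') // truncnS_gt.
Qed.

End Cylinders.

(** * Generic turns *)

Section Generic.
Variable R : realType.

(** Every open subinterval of (0,1) contains one included in [A]; equivalently,
    the interior of [A] is dense in (0,1). *)
Definition ubiquitous (A : set R) := forall x y : R, 0 <= x < y -> y <= 1 ->
  exists x' y', x' < y' /\ forall t, x' < t < y' -> x < t < y /\ A t.

Lemma baire_unit_interval (T : countType) (A : T -> set R) :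
  (forall i, ubiquitous (A i)) -> exists t, 0 < t < 1 /\ forall i, A i t.
Proof.
move=> Au.
pose B n := if unpickle n is Some i then A i else setT.
have Bu n : ubiquitous (B n).
  rewrite /B; case: (unpickle n) => [i|//]; first exact: Au.
  by move=> x y /andP[_ xy] _; exists x, y.
(* Adding the outside of (0,1) makes the sets dense in the whole line. *)
pose F n : set R := interior [set t | 0 < t < 1 -> B n t].
have FP n : open (F n) /\ dense (F n).
  split; first exact: open_interior.
  move=> O [x Ox] oO.
  have /nbhs_ballP[e /= e0 eO] : nbhs x O by exact: open_nbhs_nbhs.
  suff [x' [y' [xy' H]]] : exists x' y', x' < y' /\
      forall t, x' < t < y' -> O t /\ (0 < t < 1 -> B n t).
    exists ((x' + y') / 2); split; first by apply: (H _ _).1; lra.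
    rewrite /F /interior /=.
    have : \forall t \near (x' + y') / 2, t \in `]x', y'[.
      by apply: near_in_itvoo; rewrite in_itv /=; lra.
    by apply: filterS => t; rewrite in_itv /= => /H [].
  have ballO t : x - e < t < x + e -> O t.
    move=> te; apply: eO; rewrite /ball /= ltr_distlC; lra.
  have [meet|disj] := ltrP (Num.max (x - e) 0) (Num.min (x + e) 1).
    have [||x' [y' [xy' H]]] := Bu n (Num.max (x - e) 0) (Num.min (x + e) 1).
    - by rewrite meet le_max lexx orbT.
    - by rewrite ge_min lexx orbT.
    exists x', y'; split=> // t /H []; rewrite gt_max lt_min.
    move=> /andP[/andP[t1 t2] /andP[t3 t4]] Bt; split=> //.
    by apply: ballO; rewrite t1 t3.
  exists (x - e), (x + e); split; first by lra.
  move=> t te; split; first exact: ballO.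
  move: disj; rewrite leNgt gt_max !lt_min => disj /andP[t0 t1].
  by exfalso; move/negP: disj; apply; apply/andP; split; apply/andP; split; lra.
have /(_ `]0, 1[%classic) [] : dense (\bigcap_i F i) by exact: Baire.
- by exists (2^-1); rewrite /= in_itv /=; lra.
- exact: itv_open.
move=> t [t01 Ft]; rewrite /= in_itv /= in t01; exists t; split=> // i.
by have := interior_subset (Ft (pickle i) I) t01; rewrite /B pickleK.
Qed.

Lemma ubiquitous_le1 (A : set R) :
  (forall s t, A s -> A t -> s = t) -> ubiquitous (~` A).
Proof.
move=> A1 x y /andP[x0 xy] _.
have [[s As]|nA] := pselect (exists s, A s); last first.
  by exists x, y; split=> // t txy; split=> // At; apply: nA; exists t.
have [sz|zs] := lerP s ((x + y) / 2).
  exists ((x + y) / 2), y; split; first by lra.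
  move=> t tzy; split; first by lra.
  by move=> /A1 /(_ As) e; lra.
exists x, ((x + y) / 2); split; first by lra.
move=> t tzy; split; first by lra.
by move=> /A1 /(_ As) e; lra.
Qed.

Definition RR_approaches (j N : nat) : set R := [set t | exists n, (0 < n)%N /\
  `|RR n (exp2pii t) - RR_limit R j| < (N.+1%:R^-1)%:C].

Definition large_quotient (N : nat) : set R := [set t |
  exists i, (N <= i)%N /\
    phi R ^+ cf_denominator t i <= (partial_quotient t i.+1)%:R].

Definition generic_turns : set R := [set t | 0 < t < 1 /\ irrational t /\
  (forall N, large_quotient N t) /\ (forall j N, RR_approaches j N t)].

Lemma ubiquitous_large_quotient N : ubiquitous (large_quotient N).
Proof. exact: large_quotient_dense. Qed.

Lemma ubiquitous_RR_approaches j N : ubiquitous (RR_approaches j N).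
Proof.
move=> x y xy y1.
have e0 : 0 < N.+1%:R^-1 :> R by rewrite invr_gt0 ltr0n.
have [t [n [txy n0 Pt Rt]]] := RR_dense j xy y1 e0.
have t01 : 0 < t < 1 by lra.
have : \forall s \near t, (s \in `]x, y[) /\
    `|RR n (exp2pii s) - RR_limit R j| < (N.+1%:R^-1)%:C.
  apply: filterI; last exact: RR_near.
  by apply: near_in_itvoo; rewrite in_itv.
move=> /nbhs_ballP[d /= d0 H]; exists (t - d), (t + d); split; first by lra.
move=> s sd; have /H [] : ball t d s by rewrite /ball /= ltr_distlC; lra.
by rewrite in_itv /= => sxy sR; split=> //; exists n.
Qed.

(** The complement of a point is ubiquitous.  If the generic turns could be
    labelled injectively by natural numbers, excluding them one label at a time
    would leave a generic turn outside of the set of generic turns.  Excluding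
    each rational number makes this turn irrational. *)
Lemma uncountable_generic_turns : ~ countable generic_turns.
Proof.
move=> /countable_injP [f f_inj].
pose A (i : nat + nat * nat + rat + nat) : set R := match i with
  | inl (inl (inl N)) => large_quotient N
  | inl (inl (inr (j, N))) => RR_approaches j N
  | inl (inr r) => ~` [set ratr r]
  | inr k => ~` (generic_turns `&` [set t | f t = k])
  end.
have [t [t01 At]] : exists t, 0 < t < 1 /\ forall i, A i t.
  apply: baire_unit_interval => -[[[N|[j N]]|r]|k] /=.
  - exact: ubiquitous_large_quotient.
  - exact: ubiquitous_RR_approaches.
  - by apply: ubiquitous_le1 => s t /= -> ->.
  - apply: ubiquitous_le1 => s t [Gs fs] [Gt ft].
    by apply: f_inj; rewrite ?inE //= fs ft.
apply: (At (inr (f t))); split=> //; split=> //; split.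
  by move=> [r _ rt]; apply: (At (inl (inr r))).
split=> [N|j N]; first exact: (At (inl (inl (inl N)))).
exact: (At (inl (inl (inr (j, N))))).
Qed.

Lemma generic_turns_sub : generic_turns `<=` set_S (R := R).
Proof.
move=> t [t01 [irr [large _]]]; split=> //; split=> //.
move=> /finite_seqP [s sE].
have [i [si ai]] := large (\max_(i <- s) i).+1.
have : i \in s by have : [set` s] i by rewrite -sE.
by move=> si'; have := leq_bigmax_seq (F := id) i si' isT; rewrite leqNgt si.
Qed.

End Generic.

Theorem proposition2 (R : realType) :
  exists G : set R[i],
    G `<=` @Y_S R /\
    ~ countable G /\
    forall y : R[i], G y ->
      exists n : nat -> nat -> nat,
        forall j : nat, (1 <= j <= 10)%N ->
          (forall i : nat, (0 < n i j)%N) /\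
          ((fun i : nat => RR (n i j) y : R[i]^o) @ \oo --> (RR_limit R j : R[i]^o)).
Proof.
exists (@exp2pii R @` @generic_turns R); split.
  exact: image_subset (@generic_turns_sub R).
split.
  apply: contra_not (@uncountable_generic_turns R).
  rewrite (eq_countable (inj_card_eq _)) // => s t.
  rewrite !inE => -[/andP[s0 s1] _] [/andP[t0 t1] _].
  by apply: exp2pii_inj; rewrite ?(ltW s0) ?(ltW t0).
move=> _ [t [t01 [_ [_ near_lim]]] <-].
have /choice [n nP] : forall ij : nat * nat, exists n, (0 < n)%N /\
  `|RR n (exp2pii t) - RR_limit R ij.2| < (ij.1.+1%:R^-1)%:C.
  by move=> [i j]; exact: near_lim.
exists (fun i j => n (i, j)) => j _; split=> [i|].
  by case: (nP (i, j)).
apply/cvgrPdistC_lt => e /gt0_complexE [d d0 ->].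
have [N _ HN] := near_infty_natSinv_lt (PosNum d0).
exists N => // i Ni; have [_ /= /lt_trans] := nP (i, j); apply.
by rewrite ltcR; exact: HN.
Qed.
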